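(* Let $G$ be a connected graph with at least one edge. Then $\chi(G\,\square\,H)\le \eta(G\,\square\,H)$ holds for every connected graph $H$ with at least one edge and $\chi(G)\ge \chi(H)$ if and only if $\chi(G\,\square\,K_2)\le\eta(G\,\square\,K_2)$.
   Context: All graphs are finite, simple and undirected. $\chi$ denotes chromatic number and $\eta(G)$ is the maximum $k$ such that $K_k$ is a minor of $G$. The Cartesian product $G\,\square\,H$ has vertex set $V(G)\times V(H)$, with $(v,x)(w,y)$ an edge iff ($vw\in E(G)$ and $x=y$) or ($v=w$ and $xy\in E(H)$). A product $G\,\square\,H$ is non-trivial if $G$ and $H$ are both connected and have at least one edge. *)

(* Defs.v *)
From mathcomp Require Import all_boot.

Set Implicit Arguments.
Unset Strict Implicit.
Unset Printing Implicit Defensive.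

Record sgraph := SGraph {
  vertex :> finType;
  edge : rel vertex;
  edge_sym : symmetric edge;
  edge_irrefl : irreflexive edge
}.

Definition has_edge (G : sgraph) : bool :=
  [exists x : G, exists y : G, edge x y].

Definition edge_in (G : sgraph) (A : {set G}) : rel G :=
  [rel x y | [&& x \in A, y \in A & edge x y]].

(* The subgraph induced by A is connected; the null graph is not connected. *)
Definition connected_in (G : sgraph) (A : {set G}) : bool :=
  (A != set0) && [forall x in A, forall y in A, connect (edge_in A) x y].

Definition connected (G : sgraph) : bool := connected_in [set: G].

Section Complete.
Variable n : nat.

Definition complete_edge : rel 'I_n := [rel i j | i != j].

Lemma complete_sym : symmetric complete_edge.
Proof. by move=> i j; rewrite /complete_edge /= eq_sym. Qed.

Lemma complete_irrefl : irreflexive complete_edge.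
Proof. by move=> i; rewrite /complete_edge /= eqxx. Qed.

Definition complete : sgraph := SGraph complete_sym complete_irrefl.
End Complete.

Section Box.
Variables G H : sgraph.

Definition box_edge : rel (G * H) :=
  [rel u v | edge u.1 v.1 && (u.2 == v.2) || (u.1 == v.1) && edge u.2 v.2].

Lemma box_sym : symmetric box_edge.
Proof.
move=> u v; rewrite /box_edge /= [edge v.1 _]edge_sym [edge v.2 _]edge_sym.
by rewrite (eq_sym v.1) (eq_sym v.2).
Qed.

Lemma box_irrefl : irreflexive box_edge.
Proof. by move=> u; rewrite /box_edge /= !edge_irrefl andbF. Qed.

Definition box : sgraph := SGraph box_sym box_irrefl.
End Box.

Definition colorable (G : sgraph) (k : nat) : bool :=
  [exists f : {ffun G -> 'I_k},
     [forall x, forall y, edge x y ==> (f x != f y)]].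

Lemma colorable_ex (G : sgraph) : exists k, colorable G k.
Proof.
exists #|G|; apply/existsP; exists [ffun x : G => enum_rank x].
apply/forallP=> x; apply/forallP=> y; apply/implyP=> xy; rewrite !ffunE.
apply/eqP=> /enum_rank_inj exy.
by rewrite exy edge_irrefl in xy.
Qed.

Definition chi (G : sgraph) : nat := ex_minn (colorable_ex G).

(* H is a minor of G: there are pairwise disjoint connected (hence non-empty)
   branch sets B x in G, one for each vertex x of H, such that adjacent
   vertices of H have branch sets joined by an edge of G. *)
Definition is_model (H G : sgraph) (B : {ffun H -> {set G}}) : bool :=
  [&& [forall x, connected_in (B x)],
      [forall x, forall y, (x != y) ==> [disjoint B x & B y]]
    & [forall x, forall y, edge x y ==>
         [exists u in B x, exists v in B y, edge u v]]].

Definition minor (H G : sgraph) : bool :=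
  [exists B : {ffun H -> {set G}}, is_model B].

Lemma complete_minor_ex (G : sgraph) : exists k, minor (complete k) G.
Proof.
exists 0; apply/existsP; exists [ffun=> set0].
by apply/and3P; split; apply/forallP=> -[].
Qed.

Lemma complete_minor_le (G : sgraph) (k : nat) :
  minor (complete k) G -> k <= #|G|.
Proof.
case/existsP=> B /and3P[/forallP conB /forallP disB _].
have neB i : exists x, x \in B i.
  by apply/set0Pn; case/andP: (conB i).
pose f i := xchoose (neB i).
have fP i : f i \in B i by apply: xchooseP.
suff f_inj : injective f by rewrite -[k]card_ord; apply: leq_card f_inj.
move=> i j fij; apply/eqP; apply: contraT => nij.
have /forallP/(_ j)/implyP/(_ nij) := disB i.
by move/disjointFr/(_ (fP i)); rewrite fij fP.
Qed.

Definition eta (G : sgraph) : nat :=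
  ex_maxn (complete_minor_ex G) (@complete_minor_le G).

(* Main.v *)
Require Import Defs.
From mathcomp Require Import all_boot.

(** Adding proper k-colourings of the factors modulo k colours the product, so
    chi (G [] H) <= chi G when chi H <= chi G. Since an edge of H embeds
    G [] K_2 in G [] H, and G in turn embeds in G [] K_2, the hypothesis on
    G [] K_2 gives
    chi (G [] H) <= chi G <= chi (G [] K_2) <= eta (G [] K_2) <= eta (G [] H). *)

Lemma colorableP (G : sgraph) (k : nat) :
  reflect (exists f : G -> 'I_k, forall x y, edge x y -> f x != f y)
          (colorable G k).
Proof.
apply: (iffP existsP) => -[f fP].
  by exists f => x y; move/forallP/(_ x)/forallP/(_ y)/implyP: fP.
exists [ffun x => f x]; apply/forallP=> x; apply/forallP=> y.
by rewrite !ffunE; apply/implyP/fP.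
Qed.

Lemma chi_colorable (G : sgraph) : colorable G (chi G).
Proof. by rewrite /chi; case: ex_minnP. Qed.

Lemma chi_min (G : sgraph) (k : nat) : colorable G k -> chi G <= k.
Proof. by rewrite /chi; case: ex_minnP => m _; apply. Qed.

Lemma colorable_leq (G : sgraph) (k l : nat) :
  k <= l -> colorable G k -> colorable G l.
Proof.
move=> kl /colorableP[f fP]; apply/colorableP.
by exists (fun x => widen_ord kl (f x)) => x y /fP.
Qed.

Lemma chi_hom (G H : sgraph) (f : G -> H) :
  {homo f : x y / edge x y} -> chi G <= chi H.
Proof.
move=> homf; have /colorableP[c cP] := chi_colorable H.
by apply/chi_min/colorableP; exists (c \o f) => x y /homf/cP.
Qed.

Lemma colorable_box (G H : sgraph) (k : nat) :
  colorable G k -> colorable H k -> colorable (box G H) k.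
Proof.
move=> /colorableP[f fP] /colorableP[h hP]; apply/colorableP.
(* For [k = 0] there is no residue to choose, so positivity of the modulus is read off from the
   colour of the vertex at hand. *)
pose k_gt0 (u : box G H) : 0 < k := leq_ltn_trans (leq0n _) (ltn_ord (f u.1)).
exists (fun u => Ordinal (ltn_pmod (f u.1 + h u.2) (k_gt0 u))).
(* Along an edge of the product one summand is constant and cancels modulo [k]; the two values of
   the other are distinct and below [k], hence distinct residues. *)
move=> [x1 x2] [y1 y2] /orP[] /andP[] /=; rewrite -val_eqE /=.
  by move=> /fP nf /eqP->; rewrite eqn_modDr !modn_small.
by move=> /eqP-> /hP nh; rewrite eqn_modDl !modn_small.
Qed.

Lemma eta_minor (G : sgraph) : minor (complete (eta G)) G.
Proof. by rewrite /eta; case: ex_maxnP. Qed.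

Lemma eta_max (G : sgraph) (k : nat) : minor (complete k) G -> k <= eta G.
Proof. by rewrite /eta; case: ex_maxnP => m _; apply. Qed.

Lemma connected_in_imset (G H : sgraph) (f : G -> H) (A : {set G}) :
  {homo f : x y / edge x y} -> connected_in A -> connected_in (f @: A).
Proof.
move=> homf /andP[/set0Pn[a aA] /forall_inP conA]; apply/andP; split.
  by apply/set0Pn; exists (f a); apply: imset_f.
apply/forall_inP=> _ /imsetP[x xA ->]; apply/forall_inP=> _ /imsetP[y yA ->].
have /forall_inP/(_ y yA)/connectP[p pP ->] := conA x xA.
(* The path is mapped edge by edge. Dropping [xA] lets the starting point vary; each [edge_in] step
   gives back membership in [A]. *)
elim: p x {xA} pP => [|z p IHp] x /=; first by rewrite connect0.
case/andP=> /and3P[xA zA xz] /IHp; apply/connect_trans/connect1.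
by rewrite /edge_in /= !imset_f // homf.
Qed.

(** The images of the branch sets form the new model: preservation of edges keeps them connected and
    pairwise joined where required, and injectivity keeps them disjoint. *)
Lemma minor_embed (K G H : sgraph) (f : G -> H) :
  injective f -> {homo f : x y / edge x y} -> minor K G -> minor K H.
Proof.
move=> injf homf /existsP[B /and3P[/forallP conB /forallP disB /forallP edgeB]].
apply/existsP; exists [ffun i => f @: B i]; apply/and3P; split.
- by apply/forallP=> i; rewrite ffunE connected_in_imset.
- apply/forallP=> i; apply/forallP=> j; rewrite !ffunE imset_disjoint //.
  exact: (forallP (disB i)).
apply/forallP=> i; apply/forallP=> j; apply/implyP=> ij; rewrite !ffunE.
have /forallP/(_ j)/implyP/(_ ij) := edgeB i.
case/exists_inP=> u uB /exists_inP[v vB uv].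
apply/exists_inP; exists (f u); first exact: imset_f.
by apply/exists_inP; exists (f v); [apply: imset_f | apply: homf].
Qed.

Lemma eta_embed (G H : sgraph) (f : G -> H) :
  injective f -> {homo f : x y / edge x y} -> eta G <= eta H.
Proof. by move=> injf homf; apply/eta_max/(minor_embed _ _ _ f)/eta_minor. Qed.

(** Serves twice: for [G] it yields [chi (complete 2) <= chi G], and for [H] it supplies the second
    coordinate of the embedding of products. *)
Lemma has_edge_embed (G : sgraph) : has_edge G ->
  exists2 f : complete 2 -> G, injective f & {homo f : x y / edge x y}.
Proof.
case/existsP=> a /existsP[b ab].
have nab : a != b by apply: contraTneq ab => ->; rewrite edge_irrefl.
exists (fun i : 'I_2 => if i == ord0 then a else b).
  move=> [[|[|i]] ilt] [[|[|j]] jlt] //= eab; try exact: val_inj.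
    by rewrite eab eqxx in nab.
  by rewrite -eab eqxx in nab.
by move=> [[|[|i]] ilt] [[|[|j]] jlt] //= _; rewrite edge_sym.
Qed.

(** The successor excludes the null graph, which does not count as connected. *)
Lemma connected_complete (n : nat) : connected (complete n.+1).
Proof.
apply/andP; split; first by apply/set0Pn; exists ord0; rewrite inE.
apply/forall_inP=> x _; apply/forall_inP=> y _.
have [->|nxy] := eqVneq x y; first exact: connect0.
by apply: connect1; rewrite /edge_in /= !inE.
Qed.

Lemma has_edge_complete (n : nat) : has_edge (complete n.+2).
Proof. by apply/existsP; exists ord0; apply/existsP; exists ord_max. Qed.

Theorem mainTheorem4 (G : sgraph) (connG : connected G) (edgeG : has_edge G) :
  (forall H : sgraph, connected H -> has_edge H -> chi H <= chi G ->
     chi (box G H) <= eta (box G H))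
  <-> chi (box G (complete 2)) <= eta (box G (complete 2)).
Proof.
split=> [hadwiger | hadwigerK2 H connH edgeH chiHG].
  (* [complete 2] is itself an admissible [H], since an edge of [G] forces
     [chi (complete 2) <= chi G]. *)
  apply: hadwiger; [exact: connected_complete | exact: has_edge_complete |].
  by have [f _ /chi_hom] := has_edge_embed _ edgeG.
have chi_box : chi (box G H) <= chi G.
  apply/chi_min/colorable_box; first exact: chi_colorable.
  exact: colorable_leq chiHG (chi_colorable H).
have chi_boxK2 : chi G <= chi (box G (complete 2)).
  apply: (@chi_hom G (box G (complete 2)) (fun x => (x, ord0))) => x y xy.
  by apply/orP; left; apply/andP.
apply: leq_trans chi_box (leq_trans chi_boxK2 (leq_trans hadwigerK2 _)).
have [f injf homf] := has_edge_embed _ edgeH.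
(* The identity on [G] times the chosen edge of [H]. *)
apply: (@eta_embed _ (box G H) (fun u : box G (complete 2) => (u.1, f u.2))).
  by move=> [x i] [y j] [-> /injf ->].
move=> [x i] [y j] /orP[] /andP[] /=.
  by move=> xy /eqP->; apply/orP; left; apply/andP.
by move=> /eqP-> /homf ij; apply/orP; right; apply/andP.
Qed.
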